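(* Let $A=[a_{ij}]$ be an $n\times n$ complex matrix with constant row sum $\gamma$, and let $I=\{1,\ldots,n\}$. For $i\in I$ let $$K_{A(i)}=\bigcup_{\substack{j,k\in I\setminus\{i\}\\ j\neq k}}\Big\{z\in\mathbb{C}: |z-a_{jj}+a_{ij}|\,|z-a_{kk}+a_{ik}|\le \Big(\sum_{l\in I\setminus\{i,j\}}|a_{jl}-a_{il}|\Big)\Big(\sum_{m\in I\setminus\{i,k\}}|a_{km}-a_{im}|\Big)\Big\}.$$ Then every eigenvalue of $A$ lies in $$\bigcap_{i=1}^n\Big[K_{A(i)}\cup\{\gamma\}\Big].$$
   Context: Constant row sum $\gamma$ means $\sum_{j=1}^n a_{ij}=\gamma$ for every $i$.
   Formalization: The case n = 2 is excluded: there no distinct j, k in I\{i} exist, so K_{A(i)} is empty and the claim fails, e.g. for A = [[0,1],[1,0]] with γ = 1 and eigenvalue −1. *)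

(* Defs.v *)
From HB Require Import structures.
From mathcomp Require Import all_boot all_order all_algebra.
From mathcomp Require Import boolp classical_sets reals.
From mathcomp Require Import complex.

Set Implicit Arguments.
Unset Strict Implicit.
Unset Printing Implicit Defensive.

Import Order.TTheory GRing.Theory Num.Theory.

Local Open Scope classical_set_scope.
Local Open Scope ring_scope.

Definition constant_row_sum (R : realType) (n : nat) (A : 'M[R[i]]_n)
    (gamma : R[i]) : Prop :=
  forall s : 'I_n, \sum_(t < n) A s t = gamma.

Definition deleted_radius (R : realType) (n : nat) (A : 'M[R[i]]_n)
    (s j : 'I_n) : R[i] :=
  \sum_(l < n | (l != s) && (l != j)) `|A j l - A s l|.

(* K_{A(s)}: the Cassini ovals of the matrix of order n - 1 with entries
   a_{jl} - a_{sl} (j, l != s).  The union is over ordered pairs of distinct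
   indices different from s, so the region is empty for n <= 2.  The norm of
   R[i] takes its (real) values in R[i], whose partial order therefore compares
   both sides as real numbers. *)
Definition cassini_region (R : realType) (n : nat) (A : 'M[R[i]]_n)
    (s : 'I_n) : set R[i] :=
  \bigcup_(j in [set j | j != s])
    \bigcup_(k in [set k | k != s /\ j != k])
      [set z : R[i] | `|z - A j j + A s j| * `|z - A k k + A s k|
                        <= deleted_radius A s j * deleted_radius A s k].

(* Main.v *)
(** The row sums being constant, a left eigenvector [v] of [A] for an eigenvalue
    other than [gamma] is orthogonal to the all-ones vector, i.e. its entries
    sum to [0].  Hence subtracting row [s] from every row of [A] preserves
    [v A = z v], and deleting the entry [s] of [v] leaves a nonzero left
    eigenvector, for the same eigenvalue, of the matrix of order [n - 1] with
    entries [a_jl - a_sl].  The region K_{A(s)} consists of the ovals that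
    Brauer's Cassini theorem attaches to the rows of that matrix. *)
Require Import Defs.
From HB Require Import structures.
From mathcomp Require Import all_boot all_order all_algebra.
From mathcomp Require Import boolp classical_sets reals.
From mathcomp Require Import complex.

Set Implicit Arguments.
Unset Strict Implicit.
Unset Printing Implicit Defensive.

Import Order.TTheory GRing.Theory Num.Theory.

Local Open Scope classical_set_scope.
Local Open Scope ring_scope.

(** Eigenvalues are defined through left eigenvectors, whereas bounds by row sums require right
    ones; [A - z] and its transpose are singular together. *)
Lemma eigenvalue_trmx (F : fieldType) (n : nat) (A : 'M[F]_n) (z : F) :
  eigenvalue A^T z = eigenvalue A z.
Proof.
rewrite /eigenvalue /eigenspace !kermx_eq0 !row_free_unit -[in RHS]unitmx_tr.
by rewrite linearB /= tr_scalar_mx.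
Qed.

(** The bound [c] is left free because [x j 0] need not be the largest entry: the lemma serves for
    two rows with different bounds. *)
Lemma gershgorin_row_bound (F : numFieldType) (n : nat) (A : 'M[F]_n)
    (x : 'cV[F]_n) (z c : F) (j : 'I_n) :
    A *m x = z *: x -> (forall l, l != j -> `|x l 0| <= c) ->
  `|z - A j j| * `|x j 0| <= (\sum_(l < n | l != j) `|A j l|) * c.
Proof.
move=> /matrixP/(_ j 0) Axz x_le_c; rewrite !mxE (bigD1 j) //= in Axz.
have -> : `|z - A j j| * `|x j 0| = `|\sum_(l < n | l != j) A j l * x l 0|.
  by rewrite -normrM mulrBl -Axz addrAC subrr add0r.
apply: le_trans (ler_norm_sum _ _ _) _; rewrite mulr_suml.
by apply: ler_sum => l l_neq_j; rewrite normrM ler_wpM2l ?x_le_c.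
Qed.

(** Take [j] and [k] at the largest and second largest moduli in a right eigenvector: row [j] is
    bounded through [x k 0], row [k] through [x j 0], and in the product these factors cancel. *)
Lemma brauer_cassini (F : numFieldType) (n : nat) (A : 'M[F]_n) (z : F) :
    n <> 1%N -> eigenvalue A z ->
  exists j k : 'I_n, j != k /\
    `|z - A j j| * `|z - A k k|
      <= (\sum_(l < n | l != j) `|A j l|) * (\sum_(l < n | l != k) `|A k l|).
Proof.
move=> n_neq1; rewrite -eigenvalue_trmx => /eigenvalueP[v vAz v_neq0].
pose x := v^T; have Axz : A *m x = z *: x.
  by rewrite -[A]trmxK -trmx_mul vAz linearZ.
have [i0 xi0_neq0] : exists i, x i 0 != 0.
  by move/rV0Pn: v_neq0 => [i vi_neq0]; exists i; rewrite mxE.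
have x_real (P : pred 'I_n) : {in P, forall i, `|x i 0| \is Num.real}.
  by move=> i _; apply: normr_real.
have [j _ x_le_xj] := real_arg_maxP (isT : xpredT i0) (x_real xpredT).
have xj_gt0 : 0 < `|x j 0|.
  by apply: lt_le_trans (x_le_xj i0 isT); rewrite normr_gt0.
have [k0 k0_neq_j] : exists k, k != j.
  apply/existsP; rewrite -negb_forall; apply/negP => /forallP all_j.
  apply: n_neq1; rewrite -(card_ord n) -(card1 j); apply: eq_card => i.
  by rewrite !inE (eqP (all_j i)) eqxx.
have [k k_neq_j x_le_xk] :=
  real_arg_maxP (k0_neq_j : (fun i => i != j) k0) (x_real (fun i => i != j)).
have row_j := gershgorin_row_bound Axz x_le_xk.
have row_k : `|z - A k k| * `|x k 0| <= (\sum_(l < n | l != k) `|A k l|) * `|x j 0|.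
  by apply: gershgorin_row_bound Axz _ => l _; apply: x_le_xj.
exists j, k; split; first by rewrite eq_sym.
have [xk_eq0 | xk_neq0] := eqVneq (x k 0) 0.
  (* Here [x j 0] is the only nonzero entry, so row [j] forces [z = A j j]. *)
  move: row_j; rewrite xk_eq0 normr0 mulr0 pmulr_lle0 // normr_le0 => /eqP ->.
  by rewrite normr0 mul0r mulr_ge0 ?sumr_ge0.
have xjk_gt0 : 0 < `|x j 0| * `|x k 0| by rewrite mulr_gt0 // normr_gt0.
rewrite -(ler_pM2r xjk_gt0) mulrACA [in leRHS](mulrC `|x j 0|) [leRHS]mulrACA.
by apply: ler_pM; rewrite ?mulr_ge0.
Qed.

Definition row_difference_minor (V : zmodType) (n : nat) (A : 'M[V]_n.+1)
    (s : 'I_n.+1) : 'M[V]_n :=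
  \matrix_(j, l) (A (lift s j) (lift s l) - A s (lift s l)).

Lemma eigenvalue_row_difference_minor (F : fieldType) (n : nat)
    (A : 'M[F]_n.+1) (gamma z : F) (s : 'I_n.+1) :
    (forall i, \sum_(t < n.+1) A i t = gamma) ->
    eigenvalue A z -> z != gamma ->
  eigenvalue (row_difference_minor A s) z.
Proof.
move=> A_row_sum /eigenvalueP[v vAz v_neq0] z_neq_gamma.
have vA l : \sum_j v 0 j * A j l = z * v 0 l.
  by move/matrixP/(_ 0 l): vAz; rewrite !mxE.
have sum_v : \sum_j v 0 j = 0.
  (* Summing the entries of [v A = z v] gives [z] times the sum of [v] on one side and [gamma] times
     it on the other. *)
  have : (z - gamma) * (\sum_j v 0 j) = 0.
    rewrite mulrBl mulr_sumr (eq_bigr _ (fun l _ => esym (vA l))) exchange_big /=.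
    rewrite mulr_sumr -sumrB big1 // => j _.
    by rewrite -mulr_sumr A_row_sum mulrC subrr.
  by move/eqP; rewrite mulf_eq0 subr_eq0 (negPf z_neq_gamma) => /eqP.
have v_s : v 0 s = - \sum_(j < n) v 0 (lift s j).
  by apply/eqP; rewrite -addr_eq0; move: sum_v; rewrite (bigD1_ord s) //= => ->.
apply/eigenvalueP; exists (\row_j v 0 (lift s j)).
  (* Replacing [v 0 s] by minus the sum of the other entries is what subtracts row [s] from each
     remaining row. *)
  apply/rowP => l; rewrite !mxE -vA (bigD1_ord s) //= v_s mulNr mulr_suml.
  rewrite addrC -sumrB; apply: eq_bigr => j _.
  by rewrite !mxE mulrBr.
apply: contra_neq v_neq0 => /rowP w_eq0.
have v_lift j : v 0 (lift s j) = 0 by have := w_eq0 j; rewrite !mxE.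
apply/rowP => i; rewrite mxE; case: (unliftP s i) => [j -> // | ->].
by rewrite v_s big1 ?oppr0.
Qed.

Lemma deleted_radius_lift (R : realType) (n : nat) (A : 'M[R[i]]_n.+1)
    (s : 'I_n.+1) (j : 'I_n) :
  deleted_radius A s (lift s j) =
  \sum_(l < n | l != j) `|row_difference_minor A s j l|.
Proof.
rewrite /deleted_radius big_mkcond (bigD1_ord s) //= eqxx add0r [RHS]big_mkcond.
apply: eq_bigr => l _.
by rewrite eq_sym neq_lift (inj_eq lift_inj) mxE.
Qed.

Theorem theorem2p4 (R : realType) (n : nat) (A : 'M[R[i]]_n) (gamma : R[i])
    (n_neq2 : n <> 2%N) (A_row_sum : constant_row_sum A gamma) :
  [set z : R[i] | eigenvalue A z] `<=`
    \bigcap_(s in [set: 'I_n]) (cassini_region A s `|` [set gamma]).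
Proof.
case: n A n_neq2 A_row_sum => [|n] A n_neq2 A_row_sum z /= zA s _; first by case: s.
have [-> | z_neq_gamma] := eqVneq z gamma; first by right.
have zB := eigenvalue_row_difference_minor s A_row_sum zA z_neq_gamma.
(* A minor of order 1 offers no pair of distinct indices; a minor of order 0 has no eigenvalue. *)
have n_neq1 : n <> 1%N by move=> n1; apply: n_neq2; rewrite n1.
have [j [k [j_neq_k]]] := brauer_cassini n_neq1 zB.
rewrite -!deleted_radius_lift !mxE !opprD !opprK !addrA => oval.
left; exists (lift s j); first by rewrite /= eq_sym neq_lift.
by exists (lift s k); rewrite //= eq_sym neq_lift (inj_eq lift_inj).
Qed.
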